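(* Let $R$ be a unital ring, $\mathrm{L}$ a length function on left $R$-modules, $\Gamma$ a sofic group, $\Sigma=\{\sigma_i:\Gamma\to \mathrm{Sym}(d_i)\}_{i\in J}$ a sofic approximation net for $\Gamma$, and $\omega$ a free ultrafilter on $J$. Let $\mathcal{M}_1\subseteq \mathcal{M}_2\subseteq \mathcal{M}_3$ be locally $\mathrm{L}$-finite left $R\Gamma$-modules. Then $$ \mathrm{mL}_{\Sigma, \omega}(\mathcal{M}_2|\mathcal{M}_3)=\mathrm{mL}_{\Sigma, \omega}(\mathcal{M}_1|\mathcal{M}_3)+\mathrm{mL}_{\Sigma, \omega}(\mathcal{M}_2/\mathcal{M}_1|\mathcal{M}_3/\mathcal{M}_1).$$ In particular, for any locally $\mathrm{L}$-finite left $R\Gamma$-modules $\mathcal{M}_1\subseteq \mathcal{M}_2$, one has $$ \mathrm{mL}_{\Sigma, \omega}(\mathcal{M}_2)=\mathrm{mL}_{\Sigma, \omega}(\mathcal{M}_1|\mathcal{M}_2)+\mathrm{mL}_{\Sigma, \omega}(\mathcal{M}_2/\mathcal{M}_1).$$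
   Context: All modules are left modules. Write $[d]=\{1,\dots,d\}$, $\mathrm{Sym}(d)$ for the permutation group of $[d]$, $\mathcal{F}(\Gamma)$ for the set of all finite subsets of $\Gamma$, and $\mathscr{F}(\mathscr{M})$ for the set of all finitely generated $R$-submodules of an $R$-module $\mathscr{M}$. $R\Gamma$ is the group ring. Length function: an assignment $\mathscr{M}\mapsto \mathrm{L}(\mathscr{M})\in \mathbb{R}_{\ge 0}\cup\{+\infty\}$ on $R$-modules such that $\mathrm{L}(0)=0$; $\mathrm{L}(\mathscr{M}_2)=\mathrm{L}(\mathscr{M}_1)+\mathrm{L}(\mathscr{M}_3)$ for every short exact sequence $0\to \mathscr{M}_1\to\mathscr{M}_2\to\mathscr{M}_3\to 0$; and $\mathrm{L}(\mathscr{M})=\sup_{\mathscr{N}\in \mathscr{F}(\mathscr{M})}\mathrm{L}(\mathscr{N})$. A module is locally $\mathrm{L}$-finite if each of its finitely generated $R$-submodules has finite $\mathrm{L}$-length. Sofic approximation net for a discrete group $\Gamma$: a net of maps (not necessarily homomorphisms) $\sigma_i:\Gamma\to\mathrm{Sym}(d_i)$, $d_i\in\mathbb{N}$, indexed by a directed set $J$, such that $\lim_i |\{v\in[d_i]:\sigma_{i,s}\sigma_{i,t}(v)=\sigma_{i,st}(v)\}|/d_i=1$ for all $s,t\in \Gamma$; $\lim_i|\{v\in[d_i]:\sigma_{i,s}(v)\ne\sigma_{i,t}(v)\}|/d_i=1$ for all distinct $s,t\in\Gamma$; and $\lim_i d_i=+\infty$. $\Gamma$ is sofic if such a net exists. An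 ultrafilter $\omega$ on $J$ is free if $\{i\in J:i\ge j\}\in\omega$ for every $j\in J$. Mean length: let $\mathcal{M}_1\subseteq\mathcal{M}_2$ be $R\Gamma$-modules with $\mathcal{M}_1$ locally $\mathrm{L}$-finite, $\mathscr{A}\in\mathscr{F}(\mathcal{M}_1)$, $\mathscr{B}\in\mathscr{F}(\mathcal{M}_2)$, $F\in\mathcal{F}(\Gamma)$, and $\sigma:\Gamma\to\mathrm{Sym}(d)$ a map; write $sv=\sigma_s(v)$. For $x\in\mathcal{M}_2$, $v\in[d]$, let $\delta_vx\in\mathcal{M}_2^d$ take value $x$ at $v$ and $0$ elsewhere. Let $\mathscr{M}(\mathscr{B},F,\sigma)$ be the $R$-submodule of $\mathcal{M}_2^d$ generated by $\delta_vb-\delta_{sv}sb$ for $v\in[d]$, $b\in\mathscr{B}$, $s\in F$, and let $\mathscr{M}(\mathscr{A},\mathscr{B},F,\sigma)$ be the image of $\mathscr{A}^d$ in $\mathcal{M}_2^d/\mathscr{M}(\mathscr{B},F,\sigma)$. Define $\mathrm{mL}_{\Sigma,\omega}(\mathscr{A}|\mathscr{B},F)=\lim_{i\to\omega}\mathrm{L}(\mathscr{M}(\mathscr{A},\mathscr{B},F,\sigma_i))/d_i$, $\mathrm{mL}_{\Sigma,\omega}(\mathscr{A}|\mathscr{B})=\inf_{F\in\mathcal{F}(\Gamma)}\mathrm{mL}_{\Sigma,\omega}(\mathscr{A}|\mathscr{B},F)$, $\mathrm{mL}_{\Sigma,\omega}(\mathscr{A}|\mathcal{M}_2)=\inf_{\mathscr{B}\in\mathscr{F}(\mathcal{M}_2)}\mathrm{mL}_{\Sigma,\omega}(\mathscr{A}|\mathscr{B})$,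 $\mathrm{mL}_{\Sigma,\omega}(\mathcal{M}_1|\mathcal{M}_2)=\sup_{\mathscr{A}\in\mathscr{F}(\mathcal{M}_1)}\mathrm{mL}_{\Sigma,\omega}(\mathscr{A}|\mathcal{M}_2)$, and $\mathrm{mL}_{\Sigma,\omega}(\mathcal{M})=\mathrm{mL}_{\Sigma,\omega}(\mathcal{M}|\mathcal{M})$. *)

(* Defs.v *)
From HB Require Import structures.
From mathcomp Require Import all_boot all_order all_algebra perm.
From mathcomp Require Import generic_quotient ring_quotient.
From mathcomp Require Import finmap all_classical all_reals topology normedtype ereal.
Set Implicit Arguments.
Unset Strict Implicit.
Unset Printing Implicit Defensive.
Import Order.TTheory GRing.Theory Num.Theory.
Import numFieldNormedType.Exports.
Local Open Scope classical_set_scope.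
Local Open Scope quotient_scope.
Local Open Scope ring_scope.

Section GroupRing.
Variables (R : pzRingType) (Gam : groupType).
Implicit Types (f g h : Gam -> R) (A : {fset Gam}).

(* The group ring: finitely supported functions under convolution. *)
Definition finsupported : {pred Gam -> R} :=
  fun f => `[< finite_set [set s | f s != 0] >].

Fact finsupp_zmod : zmod_closed finsupported.
Proof.
split=> [|f g /asboolP ff /asboolP fg]; apply/asboolP.
  by apply: sub_finite_set (finite_set0 _) => s /=; rewrite eqxx.
apply: (@sub_finite_set _ _ ([set s | f s != 0] `|` [set s | g s != 0])).
  move=> s /=; have [fs0|] := eqVneq (f s) 0; last by left.
  have [gs0|] := eqVneq (g s) 0; last by right.
  by rewrite !fctE fs0 gs0 subrr eqxx.
by rewrite finite_setU.
Qed.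
HB.instance Definition _ := GRing.isZmodClosed.Build _ finsupported finsupp_zmod.

Definition group_ring : Type := {f : Gam -> R | finsupported f}.
HB.instance Definition _ := SubChoice.on group_ring.
HB.instance Definition _ := [SubChoice_isSubZmodule of group_ring by <:].
Implicit Types a b c : group_ring.

Definition gr_coef a : Gam -> R := \val a.

(* The element r s of the group ring. *)
Definition gr_term_fun (r : R) (s : Gam) : Gam -> R := fun t => r *+ (t == s).

Fact gr_term_finsupp r s : finsupported (gr_term_fun r s).
Proof.
apply/asboolP; apply: sub_finite_set (finite_set1 s) => t /=.
by rewrite /gr_term_fun; case: (t =P s) => // _; rewrite eqxx.
Qed.
Definition gr_term r s : group_ring := exist (fun f => is_true (finsupported f)) _ (gr_term_finsupp r s).

Definition gr_conv f g : Gam -> R :=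
  fun t => \sum_(s \in [set: Gam]) f s * g (s^-1 * t)%g.

Let zero_out A f := forall s, s \notin A -> f s = 0.

Fact gr_suppP a : {A | zero_out A (gr_coef a)}.
Proof.
exists (fset_set [set s | gr_coef a s != 0]) => s.
have /asboolP fa : finsupported (gr_coef a) by exact: valP.
rewrite in_fset_set // => /negP sa; apply/eqP/negPn/negP => n0.
by apply: sa; apply: mem_set.
Qed.

Fact gr_convE A f g t : zero_out A f ->
  gr_conv f g t = \sum_(s <- A) f s * g (s^-1 * t)%g.
Proof.
by move=> Af; rewrite /gr_conv (@fsbigTE _ _ _ _ A) // => s /Af ->; rewrite mul0r.
Qed.

Fact gr_conv_out A B f g : zero_out A f -> zero_out B g ->
  zero_out [fset (p.1 * p.2)%g | p in A `*` B]%fset (gr_conv f g).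
Proof.
move=> Af Bg t tAB; rewrite (gr_convE _ _ Af) big1_seq // => s /andP[_ sA].
rewrite Bg ?mulr0 //; apply: contra tAB => sB; apply/imfsetP.
by exists (s, s^-1 * t)%g; rewrite /= ?mulVKg // ?inE /= ?sA.
Qed.

Fact gr_conv_finsupp a b : finsupported (gr_conv (gr_coef a) (gr_coef b)).
Proof.
have [A Af] := gr_suppP a; have [B Bg] := gr_suppP b.
have AB := gr_conv_out Af Bg.
apply/asboolP; apply: (@sub_finite_set _ _
  [set` [fset (p.1 * p.2)%g | p in A `*` B]%fset]); last exact: finite_fset.
by move=> t; apply: contraNP => /negP /AB /eqP.
Qed.
Definition gr_mul a b : group_ring := exist (fun f => is_true (finsupported f)) _ (gr_conv_finsupp a b).

Fact gr_mulA : associative gr_mul.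
Proof.
move=> a b c; apply/val_inj/funext => t /=.
have [A Af] := gr_suppP a; have [B Bg] := gr_suppP b.
rewrite (gr_convE _ _ Af) (gr_convE _ _ (gr_conv_out Af Bg)).
set C := [fset _ | _ in _]%fset.
under [RHS]eq_bigr => u _ do rewrite /= (gr_convE _ _ Af) mulr_suml.
rewrite exchange_big /= big_seq [RHS]big_seq; apply: eq_bigr => s sA.
under [RHS]eq_bigr => u _ do rewrite -mulrA.
rewrite -mulr_sumr; congr (_ * _); rewrite /gr_conv.
rewrite -(@fsbigTE _ _ _ _ C (fun u => gr_coef b (s^-1 * u)%g * _ )); last first.
  move=> u uC; rewrite Bg ?mul0r //; apply: contra uC => sB; apply/imfsetP.
  by exists (s, s^-1 * u)%g; rewrite /= ?mulVKg // ?inE /= ?sA.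
rewrite (@reindex_fsbigT _ _ _ _ _ (fun u => s * u)%g); last first.
  by exists (fun u => s^-1 * u)%g => u; rewrite ?mulKg ?mulVKg.
by apply: eq_fsbigr => u _; rewrite mulKg invgM mulgA.
Qed.

Fact gr_mul1 : left_id (gr_term 1 1%g) gr_mul.
Proof.
move=> a; apply/val_inj/funext => t /=.
rewrite (@gr_convE [fset 1%g]%fset) => [|s]; last first.
  by rewrite inE /gr_coef /= /gr_term_fun => /negPf ->.
by rewrite big_seq_fset1 /gr_coef /= /gr_term_fun eqxx mul1r invg1 mul1g.
Qed.

Fact gr_mulr1 : right_id (gr_term 1 1%g) gr_mul.
Proof.
move=> a; apply/val_inj/funext => t /=; rewrite /gr_conv.
rewrite (@fsbigTE _ _ _ _ [fset t]%fset) => [|s].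
  by rewrite big_seq_fset1 /gr_coef /= /gr_term_fun mulVg eqxx mulr1.
rewrite inE /gr_coef /= /gr_term_fun => /negPf st.
by rewrite -[_ == _](inj_eq (mulgI s)) mulVKg mulg1 eq_sym st mulr0.
Qed.

Fact gr_mulDl : left_distributive gr_mul +%R.
Proof.
move=> a b c; apply/val_inj/funext => t /=.
have [A Af] := gr_suppP a; have [B Bg] := gr_suppP b.
have Af' : zero_out (A `|` B)%fset (gr_coef a).
  by move=> s; rewrite inE negb_or => /andP[/Af].
have Bg' : zero_out (A `|` B)%fset (gr_coef b).
  by move=> s; rewrite inE negb_or => /andP[_ /Bg].
rewrite fctE (gr_convE _ _ Af') (gr_convE _ _ Bg') -big_split /=.
rewrite (@gr_convE (A `|` B)%fset) => [|s /[dup] /Af' as0 /Bg' bs0].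
  by apply: eq_bigr => s _; rewrite -mulrDl.
by rewrite /gr_coef raddfD /= fctE [\val a s]as0 [\val b s]bs0 addr0.
Qed.

Fact gr_mulDr : right_distributive gr_mul +%R.
Proof.
move=> c a b; apply/val_inj/funext => t /=; have [C Cf] := gr_suppP c.
rewrite fctE !(gr_convE _ _ Cf) -big_split /=.
by apply: eq_bigr => s _; rewrite -mulrDr.
Qed.

HB.instance Definition _ := GRing.Zmodule_isPzRing.Build group_ring
  gr_mulA gr_mul1 gr_mulr1 gr_mulDl gr_mulDr.

Fact gr_termM r s r' s' :
  gr_term r s * gr_term r' s' = gr_term (r * r') (s * s')%g.
Proof.
apply/val_inj/funext => t /=.
rewrite (@gr_convE [fset s]%fset) => [|u]; last first.
  by rewrite inE /gr_coef /= /gr_term_fun => /negPf ->.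
rewrite big_seq_fset1 /gr_coef /= /gr_term_fun eqxx mulr1n -mulrnAr.
by rewrite -[_ == s'](inj_eq (mulgI s)) mulVKg.
Qed.

Fact gr_termD r r' s : gr_term (r + r') s = gr_term r s + gr_term r' s.
Proof. by apply/val_inj/funext => t /=; rewrite !fctE /gr_term_fun mulrnDl. Qed.

End GroupRing.

(* Restriction of scalars along r |-> r 1. *)
Section Restriction.
Variables (R : pzRingType) (Gam : groupType) (M : lmodType (group_ring R Gam)).

Definition res : Type := M.
HB.instance Definition _ := GRing.Zmodule.on res.

Definition res_scale (r : R) (x : res) : res := gr_term r (1%g : Gam) *: (x : M).

Fact res_scaleA r r' x : res_scale r (res_scale r' x) = res_scale (r * r') x.
Proof. by rewrite /res_scale scalerA gr_termM mulg1. Qed.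
Fact res_scale1 : left_id 1 res_scale.
Proof. by move=> x; rewrite /res_scale [LHS]scale1r. Qed.
Fact res_scaleDr : right_distributive res_scale +%R.
Proof. by move=> r x y; rewrite /res_scale [LHS]scalerDr. Qed.
Fact res_scaleDl x : {morph res_scale^~ x : r r' / r + r'}.
Proof. by move=> r r'; rewrite /res_scale gr_termD [LHS]scalerDl. Qed.

HB.instance Definition _ := GRing.Zmodule_isLmodule.Build R res
  res_scaleA res_scale1 res_scaleDr res_scaleDl.

Definition gr_act (s : Gam) (x : res) : res := gr_term (1 : R) s *: (x : M).

End Restriction.

Section Submodules.
Variables (R : pzRingType) (V : lmodType R).

Definition submod (N : submodClosed V) : Type := {x : V | x \in N}.
HB.instance Definition _ N := SubChoice.on (submod N).
HB.instance Definition _ N := [SubChoice_isSubLmodule of submod N by <:].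

(* The submodule generated by X. *)
Definition spanmod (X : set V) : {pred V} :=
  fun x => `[< forall N : submodClosed V, X `<=` [set` N] -> x \in N >].

Fact spanmod_submod X : submod_closed (spanmod X).
Proof.
split=> [|r x y /asboolP xX /asboolP yX]; apply/asboolP => N XN.
  exact: rpred0.
by rewrite rpredD ?rpredZ // ?xX ?yX.
Qed.
HB.instance Definition _ X := GRing.isSubmodClosed.Build R V (spanmod X)
  (spanmod_submod X).

Definition fin_gen (N : {pred V}) : Prop :=
  exists s : seq V, N =i spanmod [set` s].

(* The set of finitely generated submodules contained in N. *)
Definition fg_submods (N : {pred V}) : set (submodClosed V) :=
  [set A | fin_gen A /\ {subset A <= N}].

Section Quotient.
Variable N : submodClosed V.

Definition quot_pred : {pred V} := fun x => x \in N.
Fact quot_pred_zmod : zmod_closed quot_pred.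
Proof.
split=> [|x y xN yN]; first exact: rpred0.
by have := rpredD xN (rpredZ (-1) yN); rewrite scaleN1r.
Qed.
HB.instance Definition _ := GRing.isZmodClosed.Build V quot_pred quot_pred_zmod.

(* [{ideal_quot _}] is the quotient of an abelian group by a subgroup. *)
Definition quotmod : Type := {ideal_quot quot_pred}.
HB.instance Definition _ := GRing.Zmodule.on quotmod.

Definition quot_proj (x : V) : quotmod := \pi_({ideal_quot quot_pred}) x.

Fact quot_proj_eq x y : (quot_proj x = quot_proj y) <-> (x - y \in N).
Proof.
split=> [/eqP|xy]; first by rewrite -Quotient.idealrBE.
by apply/eqP; rewrite -Quotient.idealrBE.
Qed.

Fact quot_proj_zmod : zmod_morphism quot_proj.
Proof. by move=> x y; rewrite /quot_proj raddfB. Qed.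

Definition quot_scale (r : R) (y : quotmod) : quotmod :=
  quot_proj (r *: repr (y : {ideal_quot quot_pred})).

Fact quot_projK (y : quotmod) :
  quot_proj (repr (y : {ideal_quot quot_pred})) = y.
Proof. exact: reprK. Qed.

Fact quot_projZ r x : quot_scale r (quot_proj x) = quot_proj (r *: x).
Proof.
apply/quot_proj_eq; rewrite -scalerBr rpredZ //; apply/quot_proj_eq.
exact: quot_projK.
Qed.

HB.instance Definition _ := GRing.isZmodMorphism.Build V quotmod quot_proj
  quot_proj_zmod.

Fact quot_scaleA r r' y : quot_scale r (quot_scale r' y) = quot_scale (r * r') y.
Proof. by rewrite -[y]quot_projK !quot_projZ scalerA. Qed.
Fact quot_scale1 : left_id 1 quot_scale.
Proof. by move=> y; rewrite -[y]quot_projK quot_projZ scale1r. Qed.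
Fact quot_scaleDr : right_distributive quot_scale +%R.
Proof.
move=> r x y; rewrite -[x]quot_projK -[y]quot_projK -raddfD !quot_projZ.
by rewrite scalerDr raddfD.
Qed.
Fact quot_scaleDl y : {morph quot_scale^~ y : r r' / r + r'}.
Proof.
by move=> r r'; rewrite /= -[y]quot_projK !quot_projZ scalerDl raddfD.
Qed.
HB.instance Definition _ := GRing.Zmodule_isLmodule.Build R quotmod
  quot_scaleA quot_scale1 quot_scaleDr quot_scaleDl.

Fact quot_proj_scalable : scalable quot_proj.
Proof. by move=> r x; rewrite -quot_projZ. Qed.
HB.instance Definition _ := GRing.isScalable.Build R V quotmod *:%R quot_proj
  quot_proj_scalable.

End Quotient.
End Submodules.

Section Image.
Variables (R : pzRingType) (U V : lmodType R) (f : {linear U -> V}).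
Variable A : submodClosed U.

Definition img : {pred V} := fun y => `[< exists2 x, x \in A & f x = y >].

Fact img_submod : submod_closed img.
Proof.
split=> [|r _ _ /asboolP[x xA <-] /asboolP[y yA <-]]; apply/asboolP.
  by exists 0; rewrite ?rpred0 ?raddf0.
by exists (r *: x + y); rewrite ?rpredD ?rpredZ // linearP.
Qed.
HB.instance Definition _ := GRing.isSubmodClosed.Build R V img img_submod.
End Image.

Section Power.
Variables (R : pzRingType) (V : lmodType R) (d : nat).

Definition delta (v : 'I_d) (x : V) : {ffun 'I_d -> V} :=
  [ffun w => if w == v then x else 0].

Variable A : submodClosed V.

(* A^d as a submodule of V^d *)
Definition powmod : {pred {ffun 'I_d -> V}} := fun f => [forall v, f v \in A].

Fact powmod_submod : submod_closed powmod.
Proof.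
split=> [|r f g /forallP fA /forallP gA]; apply/forallP => v.
  by rewrite ffunE rpred0.
by rewrite !ffunE rpredD ?rpredZ.
Qed.
HB.instance Definition _ :=
  GRing.isSubmodClosed.Build R {ffun 'I_d -> V} powmod powmod_submod.
End Power.

Section LengthFunction.
Variables (K : realType) (R : pzRingType).
Local Open Scope ereal_scope.

(* Additivity also makes L invariant under isomorphism. *)
Record length_function (L : lmodType R -> \bar K) : Prop := LengthFunction {
  length_ge0 : forall V, 0 <= L V;
  length0 : forall V : lmodType R, (forall x : V, x = 0%R) -> L V = 0;
  length_exact : forall (V1 V2 V3 : lmodType R)
      (f : {linear V1 -> V2}) (g : {linear V2 -> V3}),
    injective f -> (forall z, exists y, g y = z) ->
    (forall y, g y = 0%R <-> exists x, f x = y) ->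
    L V2 = L V1 + L V3;
  length_sup : forall V,
    L V = ereal_sup [set L (submod N) | N in @fg_submods R V predT] }.

End LengthFunction.

Section SoficApproximation.
Variables (K : realType) (Gam : groupType).
Variables (disp : Order.disp_t) (J : preorderType disp).

Definition directed : Prop :=
  inhabited J /\ forall i j : J, exists k, (i <= k)%O /\ (j <= k)%O.

(* Convergence along [net_tails] is convergence of nets indexed by J. *)
Definition net_tails : set_system J :=
  filter_from [set: J] (fun j => [set i | (j <= i)%O]).

Definition proportion (n : nat) (P : {pred 'I_n}) : K := #|P|%:R / n%:R.

(* Composition is written out as the product of 'S_n is in the opposite order. *)
Record sofic_approximation_net (d : J -> nat) (sigma : forall i, Gam -> 'S_(d i))
    : Prop := SoficApproximationNet {
  sofic_directed : directed;
  sofic_mul : forall s t : Gam,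
    proportion [pred v | sigma i s (sigma i t v) == sigma i (s * t)%g v]
      @[i --> net_tails] --> (1 : K);
  sofic_free : forall s t : Gam, s != t ->
    proportion [pred v | sigma i s v != sigma i t v]
      @[i --> net_tails] --> (1 : K);
  sofic_dim : d @ net_tails --> \oo }.

Definition free_ultrafilter (omega : set_system J) : Prop :=
  UltraFilter omega /\ forall j, omega [set i | (j <= i)%O].

End SoficApproximation.

Section Relations.
Variables (R : pzRingType) (Gam : groupType).
Variables (M : lmodType (group_ring R Gam)) (d : nat) (sigma : Gam -> 'S_d).
Variables (A B : submodClosed (res M)) (F : {fset Gam}).

(* M(B, F, sigma) *)
Definition relmod : {pred {ffun 'I_d -> res M}} :=
  spanmod [set z | exists v : 'I_d, exists2 b, b \in B & exists2 s, s \in F &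
    z = delta v b - delta (sigma s v) (gr_act s b)].
HB.instance Definition _ := GRing.SubmodClosed.on relmod.

(* M(A, B, F, sigma) *)
Definition relquot : {pred quotmod relmod} :=
  img (@quot_proj _ _ relmod) (powmod A).
HB.instance Definition _ := GRing.SubmodClosed.on relquot.

End Relations.
Arguments relquot {R Gam M d} sigma A B F.

Section MeanLength.
Variables (K : realType) (R : pzRingType) (Gam : groupType).
Variable L : lmodType R -> \bar K.

(* The RGam-module N is locally L-finite. *)
Definition locally_finite (M : lmodType (group_ring R Gam)) (N : {pred M}) :=
  forall A, fg_submods (N : {pred res M}) A -> (L (submod A) < +oo)%E.

Variables (disp : Order.disp_t) (J : preorderType disp).
Variables (d : J -> nat) (sigma : forall i, Gam -> 'S_(d i)).
Variable omega : set_system J.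
Variable M : lmodType (group_ring R Gam).
Implicit Types (A B : submodClosed (res M)) (F : {fset Gam}).
Local Open Scope ereal_scope.

(* In order: mL(A|B,F), mL(A|B), mL(A|M) and mL(N|M). *)
Definition mL_ABF A B F : \bar K :=
  lim (L (submod (relquot (sigma i) A B F)) * ((d i)%:R^-1)%:E @[i --> omega]).

Definition mL_AB A B : \bar K := ereal_inf (range (mL_ABF A B)).

Definition mL_A A : \bar K :=
  ereal_inf [set mL_AB A B | B in fg_submods (predT : {pred res M})].

Definition mL (N : {pred M}) : \bar K :=
  ereal_sup [set mL_A A | A in fg_submods (N : {pred res M})].

Definition mL_full : \bar K := mL predT.

End MeanLength.

(* Main.v *)
Require Import Defs.
From HB Require Import structures.
From mathcomp Require Import all_boot all_order all_algebra perm.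
From mathcomp Require Import finmap all_classical all_reals topology normedtype ereal.
Set Implicit Arguments.
Unset Strict Implicit.
Unset Printing Implicit Defensive.
Import Order.TTheory GRing.Theory Num.Theory.
Import numFieldNormedType.Exports.
Local Open Scope ereal_scope.

(** Write f for the projection of M3 onto M3/M1, and A1, A, B, ... for finitely
    generated R-submodules. As f maps the relations of (B, F) onto those of
    (f(B), F), it induces a surjection

      M(A, B, F, sigma) -> M(f(A), f(B), F, sigma),

    and both inequalities come from its kernel, before any limit is taken.

    Lower bound for M2. If A1 is contained in A and in M1, the kernel of the
    surjection contains M(A1, B, F, sigma), so additivity of L gives
    L M(A1, B, F) + L M(f(A), f(B), F) <= L M(A, B, F)
    ([length_relquot_superadd]). Divide by d, pass to the limit and to the
    infimum over B and F; as finitely generated submodules of M2/M1 lift to M2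
    and A may be enlarged to contain any given A1, the suprema add up.

    Upper bound for M2. Given A, and E, F for the quotient, lift E to B and let
    C be a finitely generated submodule containing A, B and all s b with s in F
    and b in B. An element x of A^d that vanishes in M(f(A), E, F, sigma)
    differs from a relation m of (B, F) by an element of M1^d; since x and m
    both lie in C^d, it is an element of P^d with P the intersection of C and
    M1. The module P may fail to be finitely generated, but L(P) <= L(C) is
    finite, so P contains a finitely generated A1 with L(P/A1) <= e
    ([fg_submod_approx]). Replacing P^d by A1^d costs at most d e
    ([length_powmod_le]), hence
    L M(A, B2, F2) <= L M(A1, B2, F2) + L M(f(A), E, F) + d e
    for all B2 containing B and F2 containing F ([length_relquot_subadd]). It
    is essential that A1 is independent of sigma, B2 and F2: one can divide by
    d, take the limit, then the infimum over B2 and F2, and let e tend to 0.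

    Limits of nonnegative extended reals along an ultrafilter always exist and
    are monotone and additive ([ultra_cvg], [ultra_le_lim], [ultra_limD]), so
    these inequalities between lengths become inequalities between limits. *)

(** * Limits along an ultrafilter *)

Section UltraLimit.
Variables (K : realType) (I : Type) (omega : set_system I).
Hypothesis ultra : UltraFilter omega.
Implicit Types u v : I -> \bar K.
Local Open Scope classical_set_scope.

(** The set of x that are eventually below u is closed downwards, and an
    ultrafilter decides it at each x: any y above its supremum is eventually
    above u. The closed formula for the limit makes monotonicity immediate. *)
Lemma ultra_cvg u : (forall i, 0 <= u i) ->
  u i @[i --> omega] --> ereal_sup [set x | \forall i \near omega, x <= u i].
Proof.
move=> u0; set S := [set x | _].
have FF : ProperFilter omega := @ultra_proper _ _ ultra.
have lo y : y < ereal_sup S -> \forall i \near omega, y < u i.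
  move=> /ereal_sup_gt[x Sx yx]; apply: filterS Sx => i; exact: lt_le_trans.
have hi y : ereal_sup S < y -> \forall i \near omega, u i < y.
  move=> Sy; have [Sy'|] := in_ultra_setVsetC [set i | y <= u i] ultra.
    by move: Sy; rewrite ltNge ereal_sup_ubound.
  by apply: filterS => i /= /negP; rewrite ltNge.
have : 0 <= ereal_sup S.
  by apply: ereal_sup_ubound; exact: nearW.
case: (ereal_sup S) lo hi => [l||//] lo hi _.
  apply/fine_cvgP; split.
    have ls : l%:E < (l + 1)%:E by rewrite lte_fin ltrDl.
    apply: filterS (hi _ ls) => i ui; rewrite fin_numE.
    by move: ui (u0 i); case: (u i).
  apply/cvgrPdist_lt => e e0.
  have := lo (l - e)%:E; rewrite lte_fin ltrBlDr ltrDl => /(_ e0).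
  have := hi (l + e)%:E; rewrite lte_fin ltrDl => /(_ e0).
  apply: filterS2 => i /=; case: (u i) (u0 i) => [r||//] // _.
  by rewrite !lte_fin /= ltr_distlC => -> ->.
by apply/cvgeyPgt => A; apply: lo; rewrite ltry.
Qed.

Lemma is_cvg_ultra u : (forall i, 0 <= u i) -> cvg (u i @[i --> omega]).
Proof. by move=> u0; apply/cvg_ex; eexists; exact: ultra_cvg. Qed.

Lemma ultra_limE u : (forall i, 0 <= u i) ->
  lim (u i @[i --> omega]) = ereal_sup [set x | \forall i \near omega, x <= u i].
Proof.
move=> u0; have FF : ProperFilter omega := @ultra_proper _ _ ultra.
by apply/cvg_lim => //; exact: ultra_cvg.
Qed.

Lemma ultra_lim_ge0 u : (forall i, 0 <= u i) -> 0 <= lim (u i @[i --> omega]).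
Proof.
move=> u0; have FF : ProperFilter omega := @ultra_proper _ _ ultra.
by apply: lime_ge; [exact: is_cvg_ultra|exact: nearW].
Qed.

Lemma ultra_le_lim u v : (forall i, 0 <= u i) -> (forall i, u i <= v i) ->
  lim (u i @[i --> omega]) <= lim (v i @[i --> omega]).
Proof.
move=> u0 uv; have FF : ProperFilter omega := @ultra_proper _ _ ultra.
rewrite !ultra_limE //; last by move=> i; exact: le_trans (uv i).
by apply: ereal_sup_le => x; apply: filterS => i /le_trans -> //.
Qed.

Lemma ultra_limD u v : (forall i, 0 <= u i) -> (forall i, 0 <= v i) ->
  lim (u i + v i @[i --> omega]) =
  lim (u i @[i --> omega]) + lim (v i @[i --> omega]).
Proof.
move=> u0 v0; have FF : ProperFilter omega := @ultra_proper _ _ ultra.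
apply: limeD; [exact: is_cvg_ultra..|].
by apply: ge0_adde_def; rewrite inE; exact: ultra_lim_ge0.
Qed.

End UltraLimit.

(** * Infima and suprema of sums in the extended reals *)

Section Ereal.
Variable K : realType.
Implicit Types (c : \bar K) (S T : set (\bar K)).

(** Nonnegativity excludes the indeterminate sum of opposite infinities when
    c is infinite; for finite c one subtracts c. *)
Lemma le_ereal_inf_addr c S x : 0 <= c -> (forall y, S y -> 0 <= y) ->
  (forall y, S y -> x <= y + c) -> x <= ereal_inf S + c.
Proof.
move=> c0 S0 xS; have i0 : 0 <= ereal_inf S by exact: le_ereal_inf_tmp.
case: c c0 xS => [c||//] c0 xS.
  by rewrite -leeBlDr //; apply: le_ereal_inf_tmp => y /xS; rewrite leeBlDr.
by rewrite addey ?leey // gt_eqF // (lt_le_trans _ i0) // ltNy0.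
Qed.

(** If x is finite, the nonnegative members force both suprema to be finite, and
    one can subtract. *)
Lemma ge_ereal_supD S T x : (exists2 y, S y & 0 <= y) -> (exists2 z, T z & 0 <= z) ->
  (forall y z, S y -> T z -> y + z <= x) -> ereal_sup S + ereal_sup T <= x.
Proof.
case: x => [x [y0 Sy0 y00] [z0 Tz0 z00] STx||]; last 2 first.
- by rewrite leey.
- move=> [y Sy y0] [z Tz z0] /(_ _ _ Sy Tz).
  by rewrite leeNy_eq => /eqP yz; have := adde_ge0 y0 z0; rewrite yz.
have supT y : S y -> 0 <= y -> y + ereal_sup T <= x%:E.
  move=> Sy yge0; have yx : y <= x%:E by rewrite (le_trans _ (STx _ _ Sy Tz0)) ?leeDl.
  have yfin : y \is a fin_num by rewrite fin_numE; case: (y) yge0 yx.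
  rewrite addeC -leeBrDr //; apply: ge_ereal_sup => z Tz.
  by rewrite leeBrDr // addeC STx.
have T0 : 0 <= ereal_sup T by apply: le_trans z00 _; exact: ereal_sup_ubound.
have Tfin : ereal_sup T \is a fin_num.
  have := le_trans (leeDr _ y00) (supT _ Sy0 y00).
  by rewrite fin_numE; move: T0; case: ereal_sup.
rewrite -leeBrDr //; apply: ge_ereal_sup => y Sy; rewrite leeBrDr //.
have [/(supT _ Sy)//|/ltW yle0] := leP 0 y.
by apply: le_trans (supT _ Sy0 y00); rewrite leeD2r // (le_trans yle0).
Qed.
End Ereal.

(** * Lengths of images of submodules *)

Lemma submodB (R : pzRingType) (V : lmodType R) (N : submodClosed V) :
  {in N &, forall x y, (x - y)%R \in N}.
Proof. by move=> x y xN yN; rewrite -scaleN1r rpredD ?rpredZ. Qed.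

Lemma quot_proj_eq0 (R : pzRingType) (U : lmodType R) (N : submodClosed U) x :
  quot_proj N x = 0%R <-> x \in N.
Proof. by rewrite -[0%R](raddf0 (quot_proj N)) quot_proj_eq subr0. Qed.

Section Kernel.
Variables (R : pzRingType) (V W : lmodType R) (f : {linear V -> W}).
Variable P : submodClosed V.
Local Open Scope ring_scope.

Definition kerin : {pred V} := fun x => (x \in P) && (f x == 0).

Lemma kerin_submod : submod_closed kerin.
Proof.
split=> [|r x y /andP[xP /eqP fx] /andP[yP /eqP fy]]; apply/andP.
  by rewrite rpred0 raddf0.
by rewrite rpredD ?rpredZ // linearP fx fy scaler0 addr0.
Qed.
HB.instance Definition _ := GRing.isSubmodClosed.Build R V kerin kerin_submod.

Lemma kerinP x : reflect (x \in P /\ f x = 0) (x \in kerin).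
Proof. by apply: (iffP andP) => -[? /eqP]. Qed.
End Kernel.

Section Image.
Variables (R : pzRingType) (U V : lmodType R) (f : {linear U -> V}).
Implicit Type A : submodClosed U.

Lemma imgP A y : reflect (exists2 x, x \in A & f x = y) (y \in img f A).
Proof. exact: asboolP. Qed.

Lemma mem_img A x : x \in A -> f x \in img f A.
Proof. by move=> xA; apply/imgP; exists x. Qed.
End Image.

Section Length.
Variables (K : realType) (R : pzRingType) (L : lmodType R -> \bar K).
Hypothesis L_length : length_function L.
Implicit Types U V W : lmodType R.
Local Open Scope ring_scope.

(** Additivity of L for submodules of possibly different ambient modules. The
    map h has to be linear on P only, so that it may be given by a choice of
    preimages, as in [length_img_split]. *)
Lemma length_exact_on V W (N P : submodClosed V) (Q : submodClosed W)
    (h : V -> W) :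
    {in P &, forall x y, forall r, h (r *: x + y) = r *: h x + h y} ->
    {in P, forall x, h x \in Q} ->
    {in Q, forall z, exists2 x, x \in P & h x = z} ->
    (forall x, x \in N <-> x \in P /\ h x = 0) ->
  L (submod P) = (L (submod N) + L (submod Q))%E.
Proof.
move=> hlin hPQ hsurj hN.
have NP (x : submod N) : \val x \in P by case: ((hN _).1 (valP x)).
pose i (x : submod N) : submod P := Sub (\val x) (NP x).
pose g (x : submod P) : submod Q := Sub (h (\val x)) (hPQ _ (valP x)).
have ilin : linear i by move=> r x y; apply: val_inj; rewrite !SubK.
have glin : linear g.
  move=> r x y; apply: val_inj; rewrite !SubK.
  by apply: hlin; exact: valP.
pose iL : {linear submod N -> submod P} :=
  HB.pack i (GRing.isLinear.Build R _ _ _ i ilin).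
pose gL : {linear submod P -> submod Q} :=
  HB.pack g (GRing.isLinear.Build R _ _ _ g glin).
apply: (length_exact L_length (f := iL) (g := gL)).
- by move=> x y ixy; apply: val_inj; exact: (congr1 val ixy).
- move=> z; have [x xP hx] := hsurj _ (valP z).
  by exists (Sub x xP); apply: val_inj; rewrite -hx.
- move=> y; split=> [gy0|[x <-]].
    have yN : \val y \in N.
      by apply/hN; split; [exact: valP|exact: (congr1 val gy0)].
    by exists (Sub (\val y) yN); apply: val_inj.
  by apply: val_inj; case: ((hN _).1 (valP x)).
Qed.

Lemma length_submod_le V (N P : submodClosed V) :
  {subset N <= P} -> (L (submod N) <= L (submod P))%E.
Proof.
move=> NP; rewrite (@length_exact_on _ _ N P (img (quot_proj N) P) (quot_proj N)).
- by rewrite leeDl // length_ge0.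
- by move=> x y _ _ r; rewrite linearP.
- by move=> x; exact: mem_img.
- by move=> z /imgP.
- move=> x; rewrite quot_proj_eq0.
  by split=> [xN|[]//]; split=> //; exact: NP.
Qed.

Lemma length_submod_eq V (N P : submodClosed V) :
  N =i P -> L (submod N) = L (submod P).
Proof.
by move=> NP; apply/le_anti/andP; split; apply: length_submod_le => x; rewrite NP.
Qed.

Lemma length_img_inj V W (f : {linear V -> W}) (P : submodClosed V) :
  {in P, forall x, f x = 0 -> x = 0} -> L (submod (img f P)) = L (submod P).
Proof.
move=> finj; rewrite [RHS](@length_exact_on _ _ (kerin f P) P (img f P) f).
- rewrite [X in (X + _)%E](length0 L_length) ?add0e // => x; apply: val_inj.
  by have /kerinP[xP /(finj _ xP)] := valP x.
- by move=> x y _ _ r; rewrite linearP.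
- by move=> x; exact: mem_img.
- by move=> z /imgP.
- by move=> x; split=> /kerinP.
Qed.

(** The hypothesis says that g induces a surjection from f(P) onto g(P); its
    kernel is the image under f of the kernel of g on P. *)
Lemma length_img_split U V W (f : {linear U -> V}) (g : {linear U -> W})
    (P : submodClosed U) : {in P, forall x, f x = 0 -> g x = 0} ->
  L (submod (img f P)) =
    (L (submod (img f (kerin g P))) + L (submod (img g P)))%E.
Proof.
move=> fg; pose lift y : U := xget 0 [set x | x \in P /\ f x = y]%classic.
have liftP y : y \in img f P -> lift y \in P /\ f (lift y) = y.
  move=> /imgP[x xP fx].
  by apply: (xgetPex 0 (P := [set x | x \in P /\ f x = y]%classic)); exists x.
have gE x y : x \in P -> y \in P -> f x = f y -> g x = g y.
  move=> xP yP fxy; apply/subr0_eq; rewrite -raddfB.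
  by apply: fg; [exact: submodB|rewrite raddfB /= fxy subrr].
apply: (@length_exact_on _ _ _ _ _ (g \o lift)) => /=.
- move=> x y xP yP r; have [xL fx] := liftP _ xP; have [yL fy] := liftP _ yP.
  have [] := liftP (r *: x + y); first by rewrite rpredD ?rpredZ.
  move=> zL fz; rewrite -linearP; apply: gE => //; first by rewrite rpredD ?rpredZ.
  by rewrite fz linearP fx fy.
- by move=> x /liftP[xL _]; exact: mem_img.
- move=> _ /imgP[x xP <-]; have [xL fx] := liftP _ (mem_img f xP).
  by exists (f x); [exact: mem_img|exact: gE].
- move=> y; split=> [/imgP[x /kerinP[xP gx] <-]|[/liftP[yL fy] gy]].
    have [xL fx] := liftP _ (mem_img f xP).
    by split; [exact: mem_img|rewrite (gE _ x)].
  by apply/imgP; exists (lift y) => //; apply/kerinP.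
Qed.

Lemma length_img_sub U V (f : {linear U -> V}) (P P' : submodClosed U) :
  {in P, forall x, exists2 y, y \in P' & f x = f y} ->
  (L (submod (img f P)) <= L (submod (img f P')))%E.
Proof.
move=> PP'; apply: length_submod_le => _ /imgP[x /PP'[y yP' ->] <-].
exact: mem_img.
Qed.

Lemma length_img_quot U V W (f : {linear U -> V}) (g : {linear U -> W})
    (P : submodClosed U) : {in P, forall x, f x = 0 -> g x = 0} ->
  (L (submod (img g P)) <= L (submod (img f P)))%E.
Proof. by move=> fg; rewrite (length_img_split fg) leeDr // length_ge0. Qed.

(** f(P)/(f(P) :&: f(N)) is a quotient of p(P), because p(x) = 0 forces f(x)
    into f(N). *)
Lemma length_img_leD U V W (f : {linear U -> V}) (p : {linear U -> W})
    (N P : submodClosed U) :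
    {in P, forall x, p x = 0 -> exists2 y, y \in N & f x = f y} ->
  (L (submod (img f P)) <= L (submod (img f N)) + L (submod (img p P)))%E.
Proof.
move=> pN; pose g : {linear U -> _} := quot_proj (img f N) \o f.
have g0 x : g x = 0 <-> exists2 y, y \in N & f x = f y.
  rewrite /= quot_proj_eq0.
  by split=> [/imgP[y yN fy]|[y yN ->]]; [exists y|exact: mem_img].
rewrite (@length_img_split _ _ _ f g); last by move=> x _ /= ->; rewrite raddf0.
apply: leeD.
  by apply: length_img_sub => x /kerinP[_ /g0].
by apply: length_img_quot => x xP px; apply/g0/pN.
Qed.

End Length.

(** * Spans and finitely generated submodules *)

Section Span.
Variables (R : pzRingType) (U : lmodType R).
Local Open Scope classical_set_scope.

Lemma mem_spanmod (X : set U) x : X x -> x \in spanmod X.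
Proof. by move=> Xx; apply/asboolP => N; exact. Qed.

Lemma spanmod_min (X : set U) (N : submodClosed U) :
  X `<=` [set` N] -> {subset spanmod X <= N}.
Proof. by move=> XN x /asboolP; exact. Qed.

Lemma fin_genD (A B : submodClosed U) : fin_gen A -> fin_gen B ->
  exists C : submodClosed U, [/\ fin_gen C, {subset A <= C}, {subset B <= C} &
    forall N : submodClosed U, {subset A <= N} -> {subset B <= N} -> {subset C <= N}].
Proof.
move=> [s As] [t Bt]; exists (spanmod [set` s ++ t] : submodClosed U); split.
- by exists (s ++ t).
- move=> x; rewrite As; apply: spanmod_min => y ys; apply: mem_spanmod.
  by rewrite /= mem_cat [y \in s]ys.
- move=> x; rewrite Bt; apply: spanmod_min => y ys; apply: mem_spanmod.
  by rewrite /= mem_cat [y \in t]ys orbT.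
- move=> N AN BN; apply: spanmod_min => x /=; rewrite mem_cat => /orP[xs|xt].
    by apply: AN; rewrite As mem_spanmod.
  by apply: BN; rewrite Bt mem_spanmod.
Qed.
End Span.

Section SpanImage.
Variables (R : pzRingType) (U V : lmodType R) (f : {linear U -> V}).
Local Open Scope ring_scope.
Local Open Scope classical_set_scope.

(** The preimage of N is reached as the kernel of f followed by the projection
    modulo N, inside the span. *)
Lemma spanmod_preim (X : set U) (N : submodClosed V) :
  (forall x, X x -> f x \in N) -> {in spanmod X, forall x, f x \in N}.
Proof.
move=> XN x xX; pose g : {linear U -> _} := quot_proj N \o f.
have : x \in kerin g (spanmod X).
  apply: spanmod_min xX => y Xy; apply/kerinP.
  by split; [exact: mem_spanmod|apply/quot_proj_eq0/XN].
by move=> /kerinP[_ /quot_proj_eq0].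
Qed.

Lemma img_spanmod (X : set U) : img f (spanmod X) =i spanmod (f @` X).
Proof.
move=> y; apply/idP/idP => [/imgP[x xX <-]|].
  apply: spanmod_preim xX => z Xz; apply: mem_spanmod; by exists z.
apply: spanmod_min => _ [x Xx <-]; apply: mem_img; exact: mem_spanmod.
Qed.

Lemma fin_gen_img (A : submodClosed U) : fin_gen A -> fin_gen (img f A).
Proof.
move=> [s As]; exists (map f s) => y.
have -> : (y \in img f A) = (y \in img f (spanmod [set` s])).
  by apply/imgP/imgP => -[x xA <-]; exists x; rewrite // ?As // -As.
rewrite img_spanmod; congr (y \in spanmod _).
apply/seteqP; split=> [_ [x xs <-]|_ /mapP[x xs ->]] /=; last by exists x.
exact: map_f.
Qed.

Lemma fin_gen_lift (N : submodClosed U) (B : submodClosed V) :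
    fin_gen B -> {in B, forall y, exists2 x, x \in N & f x = y} ->
  exists2 A, fg_submods N A & img f A =i B.
Proof.
move=> [s Bs] BN; have [t tN ts] : exists2 t, {subset t <= N} & map f t = s.
  have : {subset s <= B} by move=> y ys; rewrite Bs mem_spanmod.
  elim: (s) => [|y r IH] rB; first by exists [::].
  have [|t tN <-] := IH; first by move=> z zr; rewrite rB // inE zr orbT.
  have [|x xN <-] := BN y; first by rewrite rB // mem_head.
  by exists (x :: t) => // z; rewrite inE => /predU1P[->|/tN].
exists (spanmod [set` t] : submodClosed U).
  by split; [exists t|apply: spanmod_min].
move=> y; rewrite img_spanmod Bs; congr (y \in spanmod _).
rewrite -ts; apply/seteqP; split=> [_ [x xs <-]|_ /mapP[x xs ->]] /=; last by exists x.
exact: map_f.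
Qed.

End SpanImage.

Lemma fg_submods0 (R : pzRingType) (V : lmodType R) (N : submodClosed V) :
  exists A, fg_submods N A.
Proof.
exists (spanmod [set` ([::] : seq V)] : submodClosed V).
by split; [exists [::]|exact: spanmod_min].
Qed.

Section Approximation.
Variables (K : realType) (R : pzRingType) (L : lmodType R -> \bar K).
Hypothesis L_length : length_function L.

(** A submodule of finite length is finitely generated up to length e, since
    its length is the supremum of those of its finitely generated submodules. *)
Lemma fg_submod_approx (V : lmodType R) (P : submodClosed V) (e : K) :
    L (submod P) < +oo -> (0 < e)%R ->
  exists2 A, fg_submods P A & L (submod (img (quot_proj A) P)) <= e%:E.
Proof.
move=> Poo e0; have Pfin : L (submod P) \is a fin_num.
  by rewrite ge0_fin_numE // length_ge0.
have : L (submod P) - e%:E < L (submod P).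
  by rewrite lteBlDr // lteDl // lte_fin.
rewrite {2}(length_sup L_length) => /ereal_sup_gt[_ [N [Nfg _] <-] NP].
exists (img (\val : {linear submod P -> V}) N : submodClosed V).
  split; first exact: fin_gen_img.
  by move=> _ /imgP[x _ <-]; exact: valP.
set A := img _ N.
have AE : L (submod A) = L (submod N).
  by apply: (length_img_inj L_length) => x _ x0; apply: val_inj.
have AP : {subset A <= P} by move=> _ /imgP[x _ <-]; exact: valP.
have PE : L (submod P) = L (submod A) + L (submod (img (quot_proj A) P)).
  apply: (length_exact_on L_length (h := quot_proj A)).
  - by move=> x y _ _ r; rewrite linearP.
  - by move=> x; exact: mem_img.
  - by move=> z /imgP.
  - by move=> x; rewrite quot_proj_eq0; split=> [xA|[]//]; split=> //; exact: AP.
have := length_ge0 L_length (submod (img (quot_proj A) P)).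
have := length_ge0 L_length (submod N).
move: NP Pfin; rewrite PE AE; set a := L (submod N); set b := L _.
case: a => [a||//]; case: b => [b||//] //.
rewrite lte_fin !lee_fin => + _ _ _.
by rewrite ltrBlDr ltrD2l => /ltW.
Qed.

End Approximation.

(** * Finite powers of a submodule *)

Section Power.
Variables (K : realType) (R : pzRingType) (L : lmodType R -> \bar K).
Hypothesis L_length : length_function L.
Variables (V W : lmodType R) (d : nat) (q : {linear {ffun 'I_d -> V} -> W}).
Variables A P : submodClosed V.
Local Open Scope ring_scope.

(** These lead from A^d to P^d one coordinate at a time: an element at level
    k.+1 whose coordinate of index k lies in A is at level k. *)
Definition mixpow k : {pred {ffun 'I_d -> V}} :=
  fun x => [forall v : 'I_d, x v \in (if (v < k)%N then P else A)].

Lemma mixpow_submod k : submod_closed (mixpow k).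
Proof.
split=> [|r x y /forallP xP /forallP yP]; apply/forallP => v.
  by rewrite ffunE rpred0.
by rewrite !ffunE rpredD ?rpredZ.
Qed.
HB.instance Definition _ k :=
  GRing.isSubmodClosed.Build R {ffun 'I_d -> V} (mixpow k) (mixpow_submod k).

(** Each step from [mixpow k] to [mixpow k.+1] adds at most the length of the
    image of P modulo A, where the coordinate of index k takes its values. *)
Lemma length_powmod_le :
  (L (submod (img q (powmod P))) <=
     L (submod (img q (powmod A))) +
     d%:R%:E * L (submod (img (quot_proj A) P)))%E.
Proof.
set l := L (submod (img (quot_proj A) P)).
have mix k : (k <= d)%N -> (L (submod (img q (mixpow k))) <=
    L (submod (img q (powmod A))) + k%:R%:E * l)%E.
  elim: k => [_|k IH kd].
    rewrite mul0e adde0; apply: (length_img_sub L_length) => x /forallP xA.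
    by exists x => //; apply/forallP => v; exact: xA.
  have p_lin : linear (fun x : {ffun 'I_d -> V} => quot_proj A (x (Ordinal kd))).
    by move=> r x y; rewrite !ffunE linearP.
  pose p : {linear {ffun 'I_d -> V} -> _} :=
    HB.pack (fun x : {ffun 'I_d -> V} => quot_proj A (x (Ordinal kd)))
      (GRing.isLinear.Build R _ _ _ _ p_lin).
  apply: le_trans (length_img_leD L_length (f := q) (p := p) (N := mixpow k) _) _.
    move=> x /forallP xP /quot_proj_eq0 xk; exists x => //; apply/forallP => v.
    case: (ltngtP v k) (xP v) => [vk|kv|vk _].
    - by rewrite ltnS ltnW.
    - by rewrite ltnS leqNgt kv.
    - by have -> : v = Ordinal kd by exact: val_inj.
  rewrite -natr1 EFinD ge0_muleDl ?lee_fin ?ler0n // mul1e addeA.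
  apply: leeD; first by apply: IH; exact: ltnW.
  apply: (length_submod_le L_length) => _ /imgP[x /forallP xP <-].
  by apply: mem_img; have := xP (Ordinal kd); rewrite /= ltnSn.
apply: le_trans (mix d (leqnn d)); apply: (length_img_sub L_length) => x /forallP xP.
by exists x => //; apply/forallP => v; rewrite ltn_ord.
Qed.
End Power.

(** * Restriction of scalars and relations *)

Section ResSub.
Variables (R : pzRingType) (Gam : groupType) (M : lmodType (group_ring R Gam)).
Local Open Scope ring_scope.

Lemma res_sub_submod (N : submodClosed M) :
  submod_closed ((fun x : res M => (x : M) \in N) : {pred res M}).
Proof.
by split=> [|r x y xN yN]; rewrite unfold_in; [exact: rpred0|exact/rpredD/yN/rpredZ].
Qed.
Definition res_sub (N : submodClosed M) : submodClosed (res M) :=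
  HB.pack ((fun x : res M => (x : M) \in N) : {pred res M})
    (GRing.isSubmodClosed.Build R (res M) _ (res_sub_submod N)).

(** Group elements commute with the constants of the group ring, although R
    itself need not be commutative. *)
Lemma gr_act_linear s : linear (@gr_act R Gam M s).
Proof.
move=> r x y; rewrite /gr_act [LHS]scalerDr; congr (_ + _).
by rewrite [LHS]scalerA [RHS]scalerA !gr_termM mulr1 mul1r mulg1 mul1g.
Qed.
HB.instance Definition _ s :=
  GRing.isLinear.Build R (res M) (res M) _ (@gr_act R Gam M s) (gr_act_linear s).
End ResSub.

Section ResMap.
Variables (R : pzRingType) (Gam : groupType).
Variables (M M' : lmodType (group_ring R Gam)) (f : {linear M -> M'}).
Local Open Scope ring_scope.

Lemma res_map_linear : linear (f : res M -> res M').
Proof. by move=> r x y; exact: linearP. Qed.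
Definition res_map : {linear res M -> res M'} :=
  HB.pack (f : res M -> res M') (GRing.isLinear.Build R _ _ _ _ res_map_linear).

Lemma res_map_act s x : res_map (gr_act s x) = gr_act s (res_map x).
Proof. exact: linearZ. Qed.
End ResMap.

Section PowMap.
Variables (R : pzRingType) (V W : lmodType R) (f : {linear V -> W}) (d : nat).
Local Open Scope ring_scope.

Definition pow_map (x : {ffun 'I_d -> V}) : {ffun 'I_d -> W} := [ffun v => f (x v)].

Lemma pow_map_linear : linear pow_map.
Proof. by move=> r x y; apply/ffunP => v; rewrite !ffunE linearP. Qed.
HB.instance Definition _ := GRing.isLinear.Build R _ _ _ pow_map pow_map_linear.

Lemma pow_map_delta v x : pow_map (delta v x) = delta v (f x).
Proof. by apply/ffunP => w; rewrite !ffunE; case: eqP; rewrite ?raddf0. Qed.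
End PowMap.
Arguments pow_map {R V W} f {d}.

Section PowSub.
Variables (R : pzRingType) (V : lmodType R) (d : nat) (A : submodClosed V).
Lemma powmodP (x : {ffun 'I_d -> V}) : reflect (forall v, x v \in A) (x \in powmod A).
Proof. exact: forallP. Qed.

Lemma delta_powmod (v : 'I_d) x : x \in A -> delta v x \in powmod A.
Proof. by move=> xA; apply/powmodP => w; rewrite ffunE; case: eqP; rewrite ?rpred0. Qed.
End PowSub.

Section Relmod.
Variables (R : pzRingType) (Gam : groupType) (d : nat) (sigma : Gam -> 'S_d).
Implicit Types M : lmodType (group_ring R Gam).
Implicit Type F : {fset Gam}.
Local Open Scope ring_scope.

Lemma mem_relmod M (B : submodClosed (res M)) F v b s : b \in B -> s \in F ->
  delta v b - delta (sigma s v) (gr_act s b) \in relmod sigma B F.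
Proof. by move=> bB sF; apply: mem_spanmod; exists v, b => //; exists s. Qed.

Lemma relmod_mono M (B B' : submodClosed (res M)) F F' :
  {subset B <= B'} -> {subset F <= F'} ->
  {subset relmod sigma B F <= relmod sigma B' F'}.
Proof.
move=> BB' FF'; apply: spanmod_min => _ [v [b bB [s sF ->]]].
by apply: mem_relmod; [exact: BB'|exact: FF'].
Qed.

(** The reason why a single finitely generated C controls the relations for
    all sigma at once. *)
Lemma relmod_sub_powmod M (B C : submodClosed (res M)) F : {subset B <= C} ->
    (forall s b, s \in F -> b \in B -> gr_act s b \in C) ->
  {subset relmod sigma B F <= powmod C}.
Proof.
move=> BC FBC; apply: spanmod_min => _ [v [b bB [s sF ->]]].
by apply: submodB; apply: delta_powmod; [exact: BC|exact: FBC].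
Qed.

Lemma pow_map_rel M M' (f : {linear M -> M'}) v b s :
  pow_map (res_map f) (delta v b - delta (sigma s v) (gr_act s b)) =
  delta v (res_map f b) - delta (sigma s v) (gr_act s (res_map f b)).
Proof. by rewrite -res_map_act raddfB -!pow_map_delta. Qed.

Lemma pow_map_relmod M M' (f : {linear M -> M'})
    (B : submodClosed (res M)) (B' : submodClosed (res M')) F :
    {in B, forall b, res_map f b \in B'} ->
  {in relmod sigma B F, forall x, pow_map (res_map f) x \in relmod sigma B' F}.
Proof.
move=> BB'.
apply: (spanmod_preim (f := pow_map (res_map f)) (N := relmod sigma B' F)).
move=> _ [v [b bB [s sF ->]]].
by have := mem_relmod v (BB' b bB) sF; rewrite -pow_map_rel.
Qed.

Lemma relmod_lift M M' (f : {linear M -> M'})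
    (B : submodClosed (res M)) (B' : submodClosed (res M')) F :
    {in B', forall b', exists2 b, b \in B & res_map f b = b'} ->
  {in relmod sigma B' F, forall z,
    exists2 x, x \in relmod sigma B F & pow_map (res_map f) x = z}.
Proof.
move=> BB' z zB'; apply/imgP; apply: spanmod_min zB' => _ [v [b' b'B [s sF ->]]].
have [b bB <-] := BB' _ b'B; rewrite -pow_map_rel; apply: mem_img.
exact: mem_relmod.
Qed.
End Relmod.

(** Provides the module C of [relmod_sub_powmod]: finitely many translates of B
    are added to A and B. *)
Lemma fg_act_hull (R : pzRingType) (Gam : groupType)
    (M : lmodType (group_ring R Gam)) (A B : submodClosed (res M))
    (F : {fset Gam}) : fin_gen A -> fin_gen B ->
  exists C : submodClosed (res M), [/\ fin_gen C, {subset A <= C}, {subset B <= C} &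
    forall s b, s \in F -> b \in B -> gr_act s b \in C].
Proof.
move=> Afg Bfg.
have [C [Cfg AC BC _]] := fin_genD Afg Bfg.
suff [C2 [C2fg CC2 FBC]] : exists C2 : submodClosed (res M),
    [/\ fin_gen C2, {subset C <= C2} &
       forall s b, s \in (F : seq Gam) -> b \in B -> gr_act s b \in C2].
  by exists C2; split=> // x => [/AC|/BC]; exact: CC2.
elim: (F : seq Gam) => [|s r [C2 [C2fg CC2 rC2]]]; first by exists C; split.
have [C3 [C3fg C23 sC3 _]] := fin_genD C2fg
  (fin_gen_img (@gr_act R Gam M s : {linear res M -> res M}) Bfg).
exists C3; split=> // [x /CC2/C23//|t b]; rewrite inE => /predU1P[->|tr] bB.
  by apply: sC3; exact: mem_img.
by apply/C23/rC2.
Qed.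

(** * Comparison for one map sigma *)

Section Additivity.
Variables (K : realType) (R : pzRingType) (L : lmodType R -> \bar K).
Hypothesis L_length : length_function L.
Variables (Gam : groupType) (M M' : lmodType (group_ring R Gam)).
Variable f : {linear M -> M'}.
Implicit Types A B C : submodClosed (res M).
Implicit Types D E : submodClosed (res M').
Implicit Type F : {fset Gam}.

Section OneMap.
Variables (d : nat) (sigma : Gam -> 'S_d).

Let q B F : {linear {ffun 'I_d -> res M} -> quotmod (relmod sigma B F)} :=
  quot_proj (relmod sigma B F).
Let q' E F : {linear {ffun 'I_d -> res M'} -> quotmod (relmod sigma E F)} :=
  quot_proj (relmod sigma E F).
Let qf E F : {linear {ffun 'I_d -> res M} -> quotmod (relmod sigma E F)} :=
  q' E F \o pow_map (res_map f).

(* Having the same elements is enough for equal lengths; checking that the two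
   module structures are convertible is much slower. *)
Let lengthq A B F :
  L (submod (relquot sigma A B F)) = L (submod (img (q B F) (powmod A))).
Proof. by apply: (length_submod_eq L_length) => x. Qed.

Let lengthq' D E F :
  L (submod (relquot sigma D E F)) = L (submod (img (q' E F) (powmod D))).
Proof. by apply: (length_submod_eq L_length) => x. Qed.

Lemma length_relquot_anti A B B2 F F2 : {subset B <= B2} -> {subset F <= F2} ->
  L (submod (relquot sigma A B2 F2)) <= L (submod (relquot sigma A B F)).
Proof.
move=> BB2 FF2; rewrite [leLHS](lengthq A B2 F2) [leRHS](lengthq A B F).
apply: (length_img_quot L_length) => x _ /quot_proj_eq0 xB; apply/quot_proj_eq0.
exact: relmod_mono xB.
Qed.

(** A1^d lies in the kernel of the surjection induced by f on the quotients by
    the relations. *)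
Lemma length_relquot_superadd A1 A2 B D E F :
    {subset A1 <= A2} -> {in A1, forall a, res_map f a = 0%R} ->
    {in D, forall a', exists2 a, a \in A2 & res_map f a = a'} ->
    {in B, forall b, res_map f b \in E} ->
  L (submod (relquot sigma A1 B F)) + L (submod (relquot sigma D E F)) <=
  L (submod (relquot sigma A2 B F)).
Proof.
move=> A12 fA1 DA2 BE.
have qqf : {in powmod A2, forall x, q B F x = 0%R -> qf E F x = 0%R}.
  move=> x _ /quot_proj_eq0 xB; apply/quot_proj_eq0; exact: pow_map_relmod xB.
rewrite [X in X + _ <= _](lengthq A1 B F) [X in _ + X <= _](lengthq' D E F).
rewrite [leRHS](lengthq A2 B F) [leRHS](length_img_split L_length qqf).
apply: leeD.
  apply: (length_img_sub L_length) => x /powmodP xA1; exists x => //.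
  apply/kerinP; split; first by apply/powmodP => v; exact: A12.
  rewrite /=; have -> : pow_map (res_map f) x = 0%R.
    by apply/ffunP => v; rewrite !ffunE fA1.
  by rewrite raddf0.
apply: (length_submod_le L_length) => _ /imgP[x' /powmodP x'D <-].
have [x xA2 <-] : exists2 x, x \in powmod A2 & pow_map (res_map f) x = x'.
  have /fin_all_exists2[x xA2 fx] v := DA2 _ (x'D v).
  exists [ffun v => x v]; first by apply/powmodP => v; rewrite ffunE.
  by apply/ffunP => v; rewrite !ffunE.
exact: (mem_img (qf E F)).
Qed.

(** D plays the role of the image of A, and E that of a submodule that lifts to
    B. The relations (B2, F2) may be larger than the relations (B, F) used to
    build C, so that they can be chosen after A1. *)
Lemma length_relquot_subadd A1 A B B2 C D E F F2 (e : \bar K) :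
    {subset A <= C} -> {subset B <= C} ->
    (forall s b, s \in F -> b \in B -> gr_act s b \in C) ->
    {subset B <= B2} -> {subset F <= F2} ->
    {in A, forall a, res_map f a \in D} ->
    {in E, forall b', exists2 b, b \in B & res_map f b = b'} ->
    L (submod (img (quot_proj A1) (kerin (res_map f) C))) <= e ->
  L (submod (relquot sigma A B2 F2)) <=
  L (submod (relquot sigma A1 B2 F2)) + L (submod (relquot sigma D E F)) +
  d%:R%:E * e.
Proof.
move=> AC BC FBC BB2 FF2 AD EB Ae.
rewrite [leLHS](lengthq A B2 F2) [X in _ <= X + _ + _](lengthq A1 B2 F2).
rewrite [X in _ <= _ + X + _](lengthq' D E F).
apply: le_trans (length_img_leD L_length (f := q B2 F2) (p := qf E F)
  (N := powmod (kerin (res_map f) C)) _) _.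
  move=> x /powmodP xA /quot_proj_eq0 xE; have [m mB fm] := relmod_lift EB xE.
  (* x differs from the relation m by an element killed by f *)
  exists (x - m)%R; last first.
    apply/quot_proj_eq; rewrite opprB addrCA subrr addr0.
    exact: relmod_mono mB.
  have /powmodP mC := relmod_sub_powmod BC FBC mB.
  apply/powmodP => v; apply/kerinP; rewrite !ffunE; split.
    by apply: submodB; [exact: AC|exact: mC].
  rewrite raddfB; apply/eqP; rewrite subr_eq0; apply/eqP.
  by have := congr1 (fun g : {ffun _ -> _} => g v) fm; rewrite !ffunE.
rewrite addeAC; apply: leeD; last first.
  apply: (length_submod_le L_length) => _ /imgP[x /powmodP xA <-].
  apply: (mem_img (q' E F)); apply/powmodP => v; rewrite ffunE; exact: AD.
apply: le_trans (length_powmod_le L_length (q B2 F2) A1 _) _.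
by apply: leeD => //; apply: lee_wpmul2l => //; rewrite lee_fin ler0n.
Qed.

End OneMap.
End Additivity.

(** * Mean length relative to finitely generated submodules *)

Section MeanLengthRelative.
Variables (K : realType) (R : pzRingType) (L : lmodType R -> \bar K).
Hypothesis L_length : length_function L.
Variables (Gam : groupType) (disp : Order.disp_t) (J : preorderType disp).
Variables (d : J -> nat) (sigma : forall i, Gam -> 'S_(d i)).
Variable omega : set_system J.
Hypothesis ultra : UltraFilter omega.
Implicit Types M : lmodType (group_ring R Gam).
Implicit Type F : {fset Gam}.

Notation mLF := (mL_ABF L sigma omega).

Let rate M (A B : submodClosed (res M)) F i :=
  L (submod (relquot (sigma i) A B F)) * ((d i)%:R^-1)%:E.

Let rate_ge0 M (A B : submodClosed (res M)) F i : 0 <= rate A B F i.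
Proof. by rewrite mule_ge0 ?length_ge0 // lee_fin invr_ge0 ler0n. Qed.

Lemma mL_ABF_ge0 M (A B : submodClosed (res M)) F : 0 <= mLF A B F.
Proof. exact: (ultra_lim_ge0 ultra (rate_ge0 A B F)). Qed.

Lemma mL_AB_ge0 M (A B : submodClosed (res M)) : 0 <= mL_AB L sigma omega A B.
Proof. by apply: le_ereal_inf_tmp => _ [F _ <-]; exact: mL_ABF_ge0. Qed.

Lemma mL_A_ge0 M (A : submodClosed (res M)) : 0 <= mL_A L sigma omega A.
Proof. by apply: le_ereal_inf_tmp => _ [B _ <-]; exact: mL_AB_ge0. Qed.

Lemma mL_ABF_anti (M : lmodType (group_ring R Gam)) (A B B2 : submodClosed (res M))
    (F F2 : {fset Gam}) : {subset B <= B2} -> {subset F <= F2} ->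
  mLF A B2 F2 <= mLF A B F.
Proof.
move=> BB2 FF2; apply: (ultra_le_lim ultra (rate_ge0 A B2 F2)) => i.
rewrite lee_wpmul2r //; exact: length_relquot_anti.
Qed.

Section OneMap.
Variables (M M' : lmodType (group_ring R Gam)) (f : {linear M -> M'}).
Implicit Types A B C : submodClosed (res M).
Implicit Types D E : submodClosed (res M').

Lemma mL_ABF_superadd A1 A2 B D E F :
    {subset A1 <= A2} -> {in A1, forall a, res_map f a = 0%R} ->
    {in D, forall a', exists2 a, a \in A2 & res_map f a = a'} ->
    {in B, forall b, res_map f b \in E} ->
  mLF A1 B F + mLF D E F <= mLF A2 B F.
Proof.
move=> A12 fA1 DA2 BE.
have rD i : rate A1 B F i + rate D E F i <= rate A2 B F i.
  rewrite -ge0_muleDl ?length_ge0 // lee_wpmul2r //.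
  exact: (length_relquot_superadd L_length (sigma i) F A12 fA1 DA2 BE).
have := ultra_le_lim ultra (fun i => adde_ge0 (rate_ge0 A1 B F i) (rate_ge0 D E F i)) rD.
by rewrite (ultra_limD ultra (rate_ge0 A1 B F) (rate_ge0 D E F)).
Qed.

Lemma mL_ABF_subadd A1 A B B2 C D E F F2 (e : K) : (0 <= e)%R ->
    {subset A <= C} -> {subset B <= C} ->
    (forall s b, s \in F -> b \in B -> gr_act s b \in C) ->
    {subset B <= B2} -> {subset F <= F2} ->
    {in A, forall a, res_map f a \in D} ->
    {in E, forall b', exists2 b, b \in B & res_map f b = b'} ->
    L (submod (img (quot_proj A1) (kerin (res_map f) C))) <= e%:E ->
  mLF A B2 F2 <= mLF A1 B2 F2 + mLF D E F + e%:E.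
Proof.
move=> e0 AC BC FBC BB2 FF2 AD EB Ae.
have rD i : rate A B2 F2 i <= rate A1 B2 F2 i + rate D E F i + e%:E.
  have := length_relquot_subadd L_length (sigma i) AC BC FBC BB2 FF2 AD EB Ae.
  have di0 : 0 <= ((d i)%:R^-1 : K)%:E by rewrite lee_fin invr_ge0 ler0n.
  move=> /(lee_wpmul2r di0)/le_trans; apply.
  rewrite !ge0_muleDl ?adde_ge0 ?mule_ge0 ?length_ge0 ?lee_fin ?ler0n //.
  apply: leeD => //; rewrite -!EFinM lee_fin.
  (* d * e / d is e, unless d = 0, when it is 0 by convention *)
  have [->|dn0] := eqVneq (d i) 0%N; first by rewrite !mul0r.
  by rewrite mulrAC divff ?mul1r // pnatr_eq0.
have := ultra_le_lim ultra (rate_ge0 A B2 F2) rD.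
have e0' : forall i : J, 0 <= e%:E by move=> _; rewrite lee_fin.
rewrite (ultra_limD ultra _ e0'); last first.
  by move=> i; apply: adde_ge0; exact: rate_ge0.
rewrite (ultra_limD ultra (rate_ge0 A1 B2 F2) (rate_ge0 D E F)).
have FF : ProperFilter omega := @ultra_proper _ _ ultra.
by rewrite lim_cst.
Qed.
End OneMap.
End MeanLengthRelative.

(** * Additivity *)

Section MeanLengthAdditivity.
Variables (K : realType) (R : pzRingType) (L : lmodType R -> \bar K).
Hypothesis L_length : length_function L.
Variables (Gam : groupType) (disp : Order.disp_t) (J : preorderType disp).
Variables (d : J -> nat) (sigma : forall i, Gam -> 'S_(d i)).
Variable omega : set_system J.
Hypothesis ultra : UltraFilter omega.
Variables (M : lmodType (group_ring R Gam)) (N N2 : submodClosed M).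

Let f : {linear M -> quotmod N} := quot_proj N.
Notation mL' := (mL L sigma omega).

Let f0 x : res_map f x = 0%R <-> x \in res_sub N.
Proof. exact: quot_proj_eq0. Qed.

(** The A2 that witnesses the bound contains the given A1 and a lift of D. *)
Lemma mL_superadd : {subset N <= N2} ->
  mL' N + mL' (img f N2 : {pred quotmod N}) <= mL' N2.
Proof.
move=> NN2; apply: ge_ereal_supD.
- have [A NA] := fg_submods0 (res_sub N).
  by exists (mL_A L sigma omega A); [exists A|exact: mL_A_ge0].
- have [A NA] := fg_submods0 (res_sub (img f N2)).
  by exists (mL_A L sigma omega A); [exists A|exact: mL_A_ge0].
move=> _ _ [A1 [A1fg A1N] <-] [D [Dfg DN2] <-].
have [A [Afg AN2] AD] : exists2 A, fg_submods (res_sub N2) A & img (res_map f) A =i D.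
  by apply: fin_gen_lift Dfg _ => y /DN2/imgP[x xN2 <-]; exists x.
have A1N2 : {subset A1 <= res_sub N2} by move=> x /A1N/NN2.
have [A2 [A2fg A12 AA2 /(_ _ A1N2 AN2) A2N2]] := fin_genD A1fg Afg.
apply: (@le_trans _ _ (mL_A L sigma omega A2)); last first.
  by apply: ereal_sup_ubound; exists A2.
apply: le_ereal_inf_tmp => _ [B [Bfg _] <-]; apply: le_ereal_inf_tmp => _ [F _ <-].
apply: (@le_trans _ _ (mL_ABF L sigma omega A1 B F +
    mL_ABF L sigma omega D (img (res_map f) B) F)).
  apply: leeD; apply: ge_ereal_inf.
    by exists (mL_AB L sigma omega A1 B); [exists B|exact: ereal_inf_lbound].
  exists (mL_AB L sigma omega D (img (res_map f) B)); last exact: ereal_inf_lbound.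
  by exists (img (res_map f) B : submodClosed _) => //; split=> //; exact: fin_gen_img.
apply: (mL_ABF_superadd L_length sigma ultra (f := f)) => //.
- by move=> a /A1N aN; apply/f0.
- by move=> y; rewrite -AD => /imgP[x xA <-]; exists x => //; exact: AA2.
- by move=> b bB; exact: mem_img.
Qed.

(** The order of the choices matters: A, then E and F for the quotient, then C
    and A1 inside the kernel of f on C, and only then the relations B0 and F0
    over which the infimum defining the mean length of A1 is taken. *)
Lemma mL_subadd : locally_finite L (predT : {pred M}) ->
  mL' N2 <= mL' N + mL' (img f N2 : {pred quotmod N}).
Proof.
move=> Mfin; apply: ge_ereal_sup => _ [A [Afg AN2] <-].
pose D : submodClosed (res (quotmod N)) := img (res_map f) A.
have N0 : 0 <= mL' N.
  have [B NB] := fg_submods0 (res_sub N).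
  apply: le_trans (mL_A_ge0 L_length sigma ultra B) _.
  by apply: ereal_sup_ubound; exists B.
apply: (@le_trans _ _ (mL' N + mL_A L sigma omega D)); last first.
  apply: leeD => //; apply: ereal_sup_ubound; exists D => //; split.
    exact: fin_gen_img.
  by move=> _ /imgP[x /AN2 xN2 <-]; exact: (mem_img f).
rewrite addeC; apply: le_ereal_inf_addr => //.
  by move=> _ [E _ <-]; exact: mL_AB_ge0.
move=> _ [E [Efg _] <-]; apply: le_ereal_inf_addr => //.
  by move=> _ [F _ <-]; exact: mL_ABF_ge0.
move=> _ [F _ <-].
have [B [Bfg _] BE] : exists2 B, fg_submods (spanmod setT : submodClosed (res M)) B &
    img (res_map f) B =i E.
  apply: fin_gen_lift Efg _ => y _.
  by exists (repr (y : {ideal_quot quot_pred N})); [exact: mem_spanmod|exact: quot_projK].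
have [C [Cfg AC BC FBC]] := fg_act_hull F Afg Bfg.
apply/lee_addgt0Pr => e e0.
have kerfin : L (submod (kerin (res_map f) C)) < +oo.
  apply: (@le_lt_trans _ _ (L (submod C))); last exact: Mfin.
  by apply: (length_submod_le L_length) => x /kerinP[].
have [A1 [A1fg A1C] A1e] := fg_submod_approx L_length kerfin e0.
have A1N : mL_A L sigma omega A1 <= mL' N.
  by apply: ereal_sup_ubound; exists A1 => //; split=> // x /A1C/kerinP[_ /f0].
have bound (B0 : submodClosed (res M)) (F0 : {fset Gam}) : fin_gen B0 ->
    mL_A L sigma omega A <=
    mL_ABF L sigma omega A1 B0 F0 + (mL_ABF L sigma omega D E F + e%:E).
  move=> B0fg; have [B2 [B2fg B02 BB2 _]] := fin_genD B0fg Bfg.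
  have FF2 : {subset F <= (F0 `|` F)%fset} by move=> s; rewrite inE orbC => ->.
  have AD : {in A, forall a, res_map f a \in D} by move=> a aA; exact: mem_img.
  have EB : {in E, forall y, exists2 b, b \in B & res_map f b = y}.
    by move=> y; rewrite -BE => /imgP.
  apply: (@le_trans _ _ (mL_ABF L sigma omega A B2 (F0 `|` F)%fset)).
    apply: ge_ereal_inf; exists (mL_AB L sigma omega A B2); first by exists B2.
    by apply: ereal_inf_lbound; exists (F0 `|` F)%fset.
  apply: le_trans
    (mL_ABF_subadd L_length sigma ultra (ltW e0) AC BC FBC BB2 FF2 AD EB A1e) _.
  rewrite -addeA leeD2r //; apply: (mL_ABF_anti L_length sigma ultra) => // s.
  by rewrite inE => ->.
have DEF0 := mL_ABF_ge0 L_length sigma ultra D E F.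
rewrite [X in X + _]addeC -addeA.
apply: le_trans (_ : mL_A L sigma omega A1 + (mL_ABF L sigma omega D E F + e%:E) <= _).
  apply: le_ereal_inf_addr.
  - by rewrite adde_ge0 // lee_fin ltW.
  - by move=> _ [B0 _ <-]; exact: mL_AB_ge0.
  move=> _ [B0 [B0fg _] <-]; apply: le_ereal_inf_addr.
  - by rewrite adde_ge0 // lee_fin ltW.
  - by move=> _ [F0 _ <-]; exact: mL_ABF_ge0.
  by move=> _ [F0 _ <-]; exact: bound.
by rewrite leeD2r.
Qed.

End MeanLengthAdditivity.

Lemma eq_mL (K : realType) (R : pzRingType) (L : lmodType R -> \bar K)
    (Gam : groupType) (disp : Order.disp_t) (J : preorderType disp)
    (d : J -> nat) (sigma : forall i, Gam -> 'S_(d i)) (omega : set_system J)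
    (M : lmodType (group_ring R Gam)) (N N' : {pred M}) :
  N =i N' -> mL L sigma omega N = mL L sigma omega N'.
Proof.
move=> NN'; congr (ereal_sup [set mL_A L sigma omega A | A in _]).
by apply/seteqP; split=> A [Afg AN]; split=> // x /AN; rewrite -!topredE /= => xN;
  have := NN' x; rewrite -!topredE /= xN.
Qed.

Theorem theorem1p1 (K : realType) (R : pzRingType) (L : lmodType R -> \bar K)
    (L_length : length_function L)
    (Gam : groupType)
    (disp : Order.disp_t) (J : preorderType disp)
    (d : J -> nat) (sigma : forall i : J, Gam -> 'S_(d i))
    (sigma_net : sofic_approximation_net K sigma)
    (omega : set_system J) (omega_free : free_ultrafilter omega) :
  (forall (M3 : lmodType (group_ring R Gam)) (M1 M2 : submodClosed M3),
     {subset M1 <= M2} ->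
     locally_finite L M1 -> locally_finite L M2 ->
     locally_finite L (predT : {pred M3}) ->
     mL L sigma omega M2 =
     mL L sigma omega M1 +
     mL L sigma omega (img (@quot_proj _ _ M1) M2 : {pred quotmod M1}))
  /\
  (forall (M2 : lmodType (group_ring R Gam)) (M1 : submodClosed M2),
     locally_finite L M1 -> locally_finite L (predT : {pred M2}) ->
     mL_full L sigma omega M2 =
     mL L sigma omega M1 + mL_full L sigma omega (quotmod M1)).
Proof.
have [ultra _] := omega_free.
have additive (M3 : lmodType (group_ring R Gam)) (M1 M2 : submodClosed M3) :
    {subset M1 <= M2} ->
    locally_finite L (predT : {pred M3}) ->
    mL L sigma omega M2 = mL L sigma omega M1 +
      mL L sigma omega (img (@quot_proj _ _ M1) M2 : {pred quotmod M1}).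
  move=> M12 M3fin; apply/le_anti/andP; split.
    exact: mL_subadd.
  exact: mL_superadd.
split=> [M3 M1 M2 M12 _ _ M3fin|M2 M1 _ M2fin]; first exact: additive.
pose T : submodClosed M2 := spanmod setT.
have TE (x : M2) : x \in T by exact: mem_spanmod.
rewrite /mL_full (@eq_mL _ _ _ _ _ _ _ _ _ _ predT T); last by move=> x; rewrite TE.
rewrite (additive _ M1 T) //; congr (_ + _); apply: eq_mL => y.
rewrite -[y]quot_projK; exact: (mem_img (quot_proj M1)).
Qed.
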